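(* Let $(X,\nabla)$ be a regular skew two-graph. Let $R_0,R_1,R_2,R_3$ be the trivial relations on $X^3$ and let \[ R_4=\{(x,y,z)\in X^3: (xyz)\in\nabla\},\qquad R_5=\{(x,y,z)\in X^3: (xyz)\in\mathcal C_3\setminus\nabla\}. \] Then $(X,\{R_i\}_{i=0}^5)$ is a skew-symmetric association scheme on triples whose intersection numbers satisfy $p_{444}^4=p_{445}^5=p_{455}^4=p_{555}^5=0$.
   Context: $X$ is a finite set, $\mathcal C_3$ is the set of $3$-cycles in the symmetric group on $X$; $(xyz)$ denotes the $3$-cycle $x\mapsto y\mapsto z\mapsto x$ (so $x,y,z$ are distinct). A skew two-graph is a pair $(X,\nabla)$ with $\nabla\subseteq\mathcal C_3$ such that (S1) for every $\tau\in\mathcal C_3$ exactly one of $\tau,\tau^{-1}$ is in $\nabla$ and (S2) for every $4$-subset $\{x,y,z,w\}\subseteq X$, $\nabla$ contains an even number of $(xyz),(xwy),(xzw),(ywz)$; it is regular if the number of $z$ with $(xyz)\in\nabla$ is the same for all ordered pairs of distinct $x,y$. The trivial relations are $R_0=\{(x,x,x)\}$, $R_1=\{(x,y,y):x\ne y\}$, $R_2=\{(x,y,x):x\neq y\}$, $R_3=\{(x,x,y):x\neq y\}$. For $\sigma\in S_3$ and $R\subseteq X^3$, $\sigma(R)=\{(y_{\sigma(1)},y_{\sigma(2)},y_{\sigma(3)}):(y_1,y_2,y_3)\in R\}$. A partition $\{R_0,\dots,R_m\}$ of $X^3$ is an association scheme on triples (AST) if: (I) $R_0,\dots,R_3$ are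 the trivial relations; (II) for each $i$ and $\sigma\in S_3$, $\sigma(R_i)=R_j$ for some $j$; (III) for distinct $y,z$ and each $i$, $|\{x:(x,y,z)\in R_i\}|$ depends only on $i$; (IV) for all $i,j,k,\ell$ and $(x,y,z)\in R_\ell$, the number $p_{ijk}^\ell=|\{w\in X:(w,y,z)\in R_i,(x,w,z)\in R_j,(x,y,w)\in R_k\}|$ depends only on $i,j,k,\ell$. An AST with $m=5$ is skew-symmetric if (SS1) $R_4,R_5$ are invariant under the permutation $(123)\in S_3$ and (SS2) $\sigma(R_4)\cap R_4=\sigma(R_5)\cap R_5=\emptyset$ for $\sigma=(12)$. *)

(* Defs.v *)
From mathcomp Require Import all_boot all_fingroup.

Set Implicit Arguments.
Unset Strict Implicit.
Unset Printing Implicit Defensive.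

Section SkewTwoGraphs.

Variable X : finType.
Implicit Types (x y z w : X) (nabla : {set {perm X}}).

(* The 3-cycle (x y z), mapping x to y, y to z and z to x; see [cycle3P].
   For x, y, z not distinct the value is a junk permutation, hence the [uniq]
   guards below. *)
Definition cycle3 x y z : {perm X} := (tperm x y * tperm x z)%g.

Lemma cycle3P x y z : uniq [:: x; y; z] ->
  [/\ cycle3 x y z x = y, cycle3 x y z y = z, cycle3 x y z z = x
    & forall w, w \notin [:: x; y; z] -> cycle3 x y z w = w].
Proof.
rewrite /= !inE negb_or !andbT => /andP[/andP[xy xz] yz].
rewrite /cycle3; split=> [|||w].
- by rewrite permM tpermL tpermD // eq_sym.
- by rewrite permM tpermR tpermL.
- by rewrite permM (tpermD xz yz) tpermR.
rewrite !inE !negb_or => /and3P[wx wy wz].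
by rewrite permM !tpermD // eq_sym.
Qed.

Definition three_cycles : {set {perm X}} :=
  [set s | [exists x, exists y, exists z,
             uniq [:: x; y; z] && (s == cycle3 x y z)]].

Definition skew_two_graph nabla : Prop :=
  [/\ nabla \subset three_cycles,
      forall s, s \in three_cycles -> (s \in nabla) (+) (s^-1%g \in nabla)
    & forall x y z w, uniq [:: x; y; z; w] ->
        ~~ odd (count (mem nabla) [:: cycle3 x y z; cycle3 x w y;
                                      cycle3 x z w; cycle3 y w z])].

Definition regular_skew_two_graph nabla : Prop :=
  skew_two_graph nabla /\
  exists k : nat, forall x y, x != y ->
    #|[set z | uniq [:: x; y; z] && (cycle3 x y z \in nabla)]| = k.

End SkewTwoGraphs.

Section SchemesOnTriples.

Variable X : finType.

Definition relation_of (P : X -> X -> X -> bool) : {set 3.-tuple X} :=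
  [set t | P (tnth t (inord 0)) (tnth t (inord 1)) (tnth t (inord 2))].

Lemma in_relation_of P x y z : ([tuple x; y; z] \in relation_of P) = P x y z.
Proof. by rewrite inE !(tnth_nth x) !inordK. Qed.

Definition trivial0 : {set 3.-tuple X} :=
  relation_of (fun x y z => (x == y) && (y == z)).
Definition trivial1 : {set 3.-tuple X} :=
  relation_of (fun x y z => (x != y) && (y == z)).
Definition trivial2 : {set 3.-tuple X} :=
  relation_of (fun x y z => (x != y) && (x == z)).
Definition trivial3 : {set 3.-tuple X} :=
  relation_of (fun x y z => (x == y) && (y != z)).

Definition permute_rel (s : 'S_3) (A : {set 3.-tuple X}) : {set 3.-tuple X} :=
  [set [tuple tnth t (s i) | i < 3] | t in A].

Definition intersection_number m (R : 'I_m.+1 -> {set 3.-tuple X})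
    (i j k l : 'I_m.+1) (p : nat) : Prop :=
  forall x y z : X, [tuple x; y; z] \in R l ->
    #|[set w : X | [&& [tuple w; y; z] \in R i, [tuple x; w; z] \in R j
                     & [tuple x; y; w] \in R k]]| = p.

(* The cells of a partition are nonempty; this is required as soon as X has
   at least three points. On fewer points there is no triple of distinct points,
   so every nontrivial cell is necessarily empty, and empty cells are allowed. *)
Definition indexed_partition m (R : 'I_m.+1 -> {set 3.-tuple X}) : Prop :=
  [/\ forall i j, i != j -> [disjoint R i & R j],
      \bigcup_i R i = [set: 3.-tuple X]
    & 2 < #|X| -> forall i, R i != set0].

Definition association_scheme_on_triples m
    (R : 'I_m.+1 -> {set 3.-tuple X}) : Prop :=
  [/\ indexed_partition R,
      [/\ 2 < m, R (inord 0) = trivial0, R (inord 1) = trivial1,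
          R (inord 2) = trivial2 & R (inord 3) = trivial3],
      forall i (s : 'S_3), exists j, permute_rel s (R i) = R j,
      forall i, exists n : nat, forall y z : X, y != z ->
        #|[set x : X | [tuple x; y; z] \in R i]| = n
    & forall i j k l, exists p : nat, intersection_number R i j k l p].

(* The points 1, 2, 3 permuted by S_3 are 0, 1, 2 here. *)
Definition perm123 : 'S_3 := perm (@ordS_inj 3).
Definition perm12 : 'S_3 := tperm (inord 0) (inord 1).

Definition skew_symmetric_AST (R : 'I_6 -> {set 3.-tuple X}) : Prop :=
  [/\ association_scheme_on_triples R,
      permute_rel perm123 (R (inord 4)) = R (inord 4),
      permute_rel perm123 (R (inord 5)) = R (inord 5),
      permute_rel perm12 (R (inord 4)) :&: R (inord 4) = set0
    & permute_rel perm12 (R (inord 5)) :&: R (inord 5) = set0].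

Definition two_graph_relations (nabla : {set {perm X}}) :
    'I_6 -> {set 3.-tuple X} :=
  tnth [tuple trivial0; trivial1; trivial2; trivial3;
    relation_of (fun x y z =>
      uniq [:: x; y; z] && (cycle3 x y z \in nabla));
    relation_of (fun x y z =>
      uniq [:: x; y; z] && (cycle3 x y z \in three_cycles X :\: nabla))].

End SchemesOnTriples.

(* Main.v *)
(* Number the relation containing (x, y, z) by tau(x, y, z) in {0, ..., 5}. For
   w outside {x, y, z}, (S2) says that the number of 4's among tau(w, y, z),
   tau(x, w, z), tau(x, y, w) has the opposite parity to [tau(x, y, z) = 4].
   This gives the four vanishing intersection numbers. It also leaves only four
   possible nontrivial types for w, which form a coset of the even-weight code
   of length 3; the number of w of a given type is then half of
   3k + const - |X|, obtained by adding the three one-coordinate counts, each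
   of which is the regularity constant k. *)
Require Import Defs.
From mathcomp Require Import all_boot all_fingroup.
From mathcomp Require Import zify.

Set Implicit Arguments.
Unset Strict Implicit.
Unset Printing Implicit Defensive.

(** * 3-cycles under inversion and rotation, and coordinate swaps on relation numbers *)

Lemma cycle3V (X : finType) (x y z : X) :
  cycle3 x z y = ((cycle3 x y z)^-1)%g.
Proof. by rewrite /cycle3 invMg !tpermV. Qed.

Lemma cycle3_rot (X : finType) (x y z : X) :
  uniq [:: x; y; z] -> cycle3 y z x = cycle3 x y z.
Proof.
move=> U; have U' : uniq [:: y; z; x] by rewrite -(rot_uniq 1) in U.
have [xE yE zE oE] := cycle3P U; have [yE' zE' xE' oE'] := cycle3P U'.
apply/permP => w; have [->|wx] := eqVneq w x; first by rewrite xE.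
have [->|wy] := eqVneq w y; first by rewrite yE.
have [->|wz] := eqVneq w z; first by rewrite zE.
by rewrite oE ?oE' // !inE !negb_or wx wy wz.
Qed.

Lemma cycle3_three_cycles (X : finType) (x y z : X) :
  uniq [:: x; y; z] -> cycle3 x y z \in three_cycles X.
Proof.
move=> U; rewrite inE; apply/existsP; exists x; apply/existsP; exists y.
by apply/existsP; exists z; rewrite U eqxx.
Qed.

(** How the relation number changes when the first two coordinates trade places: (x, y, y) becomes
    (y, x, y), and (S1) exchanges 4 and 5. Fixing every other number keeps it an involution of all
    of [nat]. *)
Definition swap12 (n : nat) : nat :=
  match n with 1 => 2 | 2 => 1 | 4 => 5 | 5 => 4 | _ => n end.

Definition swap23 (n : nat) : nat :=
  match n with 2 => 3 | 3 => 2 | 4 => 5 | 5 => 4 | _ => n end.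

Lemma swap12K : involutive swap12.
Proof. by do 6?[case=> //]. Qed.

Lemma swap23K : involutive swap23.
Proof. by do 6?[case=> //]. Qed.

Lemma swap12_lt6 n : n < 6 -> swap12 n < 6.
Proof. by move: n; do 6?[case=> //]. Qed.

Lemma swap23_lt6 n : n < 6 -> swap23 n < 6.
Proof. by move: n; do 6?[case=> //]. Qed.

(** * The index of a triple, its skewness and its parity *)

Section RelationIndex.

Variables (X : finType) (nabla : {set {perm X}}).

(** Since the index is a function of the triple, disjointness and covering of the relations are
    immediate; values in [nat] allow direct matching. *)
Definition triple_index (x y z : X) : nat :=
  if y == z then (if x == y then 0 else 1)
  else if x == z then 2 else if x == y then 3
  else if cycle3 x y z \in nabla then 4 else 5.

Local Notation tau := triple_index.

Lemma triple_index_lt6 x y z : tau x y z < 6.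
Proof. by rewrite /tau; do !case: ifP. Qed.

Lemma mem_two_graph_relations i (t : 3.-tuple X) :
  (t \in two_graph_relations nabla i) =
  (tau (tnth t (inord 0)) (tnth t (inord 1)) (tnth t (inord 2)) == i).
Proof.
(* The cycle of a [uniq] triple is always a 3-cycle, so the complement inside [three_cycles] is
   plain non-membership. *)
have U3 x y z : uniq [:: x; y; z] && (cycle3 x y z \in three_cycles X :\: nabla)
    = uniq [:: x; y; z] && (cycle3 x y z \notin nabla).
  by rewrite in_setD; case U: uniq; rewrite // cycle3_three_cycles // andbT.
rewrite /two_graph_relations (tnth_nth (trivial0 X)).
case: i => -[|[|[|[|[|[|//]]]]]] i6; rewrite [in LHS]inE /tau ?U3;
  move: (tnth t (inord 0)) (tnth t (inord 1)) (tnth t (inord 2)) => x y z;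
  rewrite /= ?inE ?negb_or ?andbT;
  (have [->|yz] := eqVneq y z; last have [->|xz] := eqVneq x z);
  rewrite ?eqxx ?andbT ?andbF //=; try by rewrite eq_sym (negPf yz).
all: by do 2?[case: ifP => //].
Qed.

Lemma mem3_two_graph_relations i x y z :
  ([tuple x; y; z] \in two_graph_relations nabla i) = (tau x y z == i).
Proof. by rewrite mem_two_graph_relations !(tnth_nth x) !inordK. Qed.

Hypothesis stg : skew_two_graph nabla.

Lemma cycle3_skew x y z : uniq [:: x; y; z] ->
  (cycle3 x z y \in nabla) = (cycle3 x y z \notin nabla).
Proof.
case: stg => _ S1 _ U; have := S1 _ (cycle3_three_cycles U).
by rewrite -cycle3V; case: (_ \in _); case: (_ \in _).
Qed.

Lemma triple_index_swap23 x y z : tau x z y = swap23 (tau x y z).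
Proof.
rewrite /tau eq_sym.
have [->|yz] := eqVneq y z; first by case: ifP.
have [->|xz] := eqVneq x z; first by rewrite eq_sym (negPf yz).
have [//|xy] := eqVneq x y.
by rewrite cycle3_skew ?if_neg; [case: ifP | rewrite /= !inE !negb_or xy xz yz].
Qed.

Lemma triple_index_swap12 x y z : tau y x z = swap12 (tau x y z).
Proof.
rewrite /tau (eq_sym y x).
have [->|xz] := eqVneq x z; first by rewrite (eq_sym y z); case: ifP.
have [->//|yz] := eqVneq y z; first by rewrite (negPf xz).
have [//|xy] := eqVneq x y.
have U : uniq [:: y; z; x] by rewrite /= !inE !negb_or yz eq_sym xy eq_sym xz.
rewrite (cycle3_skew U) cycle3_rot ?if_neg; first by case: ifP.
by rewrite /= !inE !negb_or xy xz yz.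
Qed.

(* (S2) with each of the last three cycles inverted, so as to match the triples
   of (IV). *)
Lemma cycle3_parity x y z w : uniq [:: x; y; z; w] ->
  (cycle3 w y z \in nabla) (+) (cycle3 x w z \in nabla)
    (+) (cycle3 x y w \in nabla) = (cycle3 x y z \notin nabla).
Proof.
case: stg => _ _ S2 U; have := S2 _ _ _ _ U.
move: U; rewrite /= !inE !negb_or !andbT => /and3P[/and3P[xy xz xw] /andP[yz yw] zw].
rewrite (@cycle3_skew x y w) ?(@cycle3_skew x w z) ?(@cycle3_skew y z w);
  try by rewrite /= !inE !negb_or 1?(eq_sym w) ?xy ?xz ?xw ?yz ?yw ?zw.
rewrite (@cycle3_rot _ w y z); last first.
  by rewrite /= !inE !negb_or !(eq_sym w) ?yw ?yz ?zw.
by do 4!case: (_ \in _).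
Qed.


(** * The action of S_3 on the relations *)

Definition index_of (t : 3.-tuple X) : nat :=
  tau (tnth t (inord 0)) (tnth t (inord 1)) (tnth t (inord 2)).

Definition permute_triple (s : 'S_3) (t : 3.-tuple X) : 3.-tuple X :=
  [tuple tnth t (s i) | i < 3].

Lemma permute_tripleK s : cancel (permute_triple s) (permute_triple s^-1%g).
Proof. by move=> t; apply: eq_from_tnth => i; rewrite !tnth_mktuple permKV. Qed.

Lemma permute_tripleKV s : cancel (permute_triple s^-1%g) (permute_triple s).
Proof. by move=> t; apply: eq_from_tnth => i; rewrite !tnth_mktuple permK. Qed.

Lemma ord3_cases (i : 'I_3) : [\/ i = inord 0, i = inord 1 | i = inord 2].
Proof.
by case: i => -[|[|[|//]]] i3; [apply: Or31 | apply: Or32 | apply: Or33];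
  apply: val_inj; rewrite /= inordK.
Qed.

(** Adjacent transpositions generate S_3, so [h] is a composite of [swap12] and [swap23]. Its
    injectivity lets membership be pulled back, and the bound makes [h i] an index again. *)
Lemma index_of_permute s : exists h : nat -> nat,
  [/\ injective h, forall n, n < 6 -> h n < 6
    & forall t, index_of (permute_triple s t) = h (index_of t)].
Proof.
suff [h [h_inj h6] hE] : exists2 h : nat -> nat,
    injective h /\ (forall n, n < 6 -> h n < 6)
    & forall f : 'I_3 -> X,
        tau (f (s (inord 0))) (f (s (inord 1))) (f (s (inord 2))) =
        h (tau (f (inord 0)) (f (inord 1)) (f (inord 2))).
  by exists h; split=> // t; rewrite /index_of !tnth_mktuple.
have s_neq a b : a < 3 -> b < 3 -> a != b -> s (inord a) <> s (inord b).
  move=> a3 b3 /eqP ab /perm_inj /(congr1 (@nat_of_ord 3)).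
  by rewrite !inordK.
have s01 := s_neq 0 1 isT isT isT; have s02 := s_neq 0 2 isT isT isT.
have s12 := s_neq 1 2 isT isT isT.
have inj12 := inv_inj swap12K; have inj23 := inv_inj swap23K.
have s12_6 := swap12_lt6; have s23_6 := swap23_lt6.
case: (ord3_cases (s (inord 0))) (ord3_cases (s (inord 1)))
  (ord3_cases (s (inord 2))) => E0 [] E1 [] E2;
  move: s01 s02 s12; rewrite ?E0 ?E1 ?E2 // => _ _ _.
- by exists id => //; split=> // m n.
- by exists swap23 => // f; rewrite triple_index_swap23.
- by exists swap12 => // f; rewrite triple_index_swap12.
- exists (swap23 \o swap12) => [|f /=]; first by split; [apply: inj_comp | move=> n ? /=; auto].
  by rewrite triple_index_swap23 triple_index_swap12.
- exists (swap12 \o swap23) => [|f /=]; first by split; [apply: inj_comp | move=> n ? /=; auto].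
  by rewrite triple_index_swap12 triple_index_swap23.
exists (swap12 \o swap23 \o swap12) => [|f /=].
  by split; [apply: inj_comp => //; apply: inj_comp | move=> n ? /=; auto].
by rewrite triple_index_swap12 triple_index_swap23 triple_index_swap12.
Qed.

Lemma mem_permute_rel s (A : {set 3.-tuple X}) t :
  (permute_triple s t \in permute_rel s A) = (t \in A).
Proof. by rewrite (mem_imset _ _ (can_inj (permute_tripleK s))). Qed.

Local Notation R := (two_graph_relations nabla).

(** [permute_triple s] is onto, so the equality can be tested on its images, where injectivity of
    [h] turns index [j] back into index [i]. *)
Lemma permute_two_graph_relation s (h : nat -> nat) (i j : 'I_6) :
    injective h -> h i = j ->
    (forall t, index_of (permute_triple s t) = h (index_of t)) ->
  permute_rel s (R i) = R j.
Proof.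
move=> h_inj hij hE; apply/setP => t; rewrite -[t](permute_tripleKV s).
by rewrite mem_permute_rel !mem_two_graph_relations -!/(index_of _) hE -hij inj_eq.
Qed.

Lemma permute_two_graph_relations i s : exists j, permute_rel s (R i) = R j.
Proof.
have [h [h_inj h6 hE]] := index_of_permute s.
exists (inord (h i)); apply: (permute_two_graph_relation h_inj) => //.
by rewrite inordK ?h6.
Qed.

Lemma index_of_perm123 t :
  index_of (permute_triple perm123 t) = swap23 (swap12 (index_of t)).
Proof.
rewrite /index_of !tnth_mktuple -triple_index_swap12 -triple_index_swap23.
by congr (tau (tnth t _) (tnth t _) (tnth t _));
  apply: val_inj; rewrite permE /= !inordK.
Qed.

Lemma index_of_perm12 t :
  index_of (permute_triple perm12 t) = swap12 (index_of t).
Proof.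
rewrite /index_of !tnth_mktuple -triple_index_swap12 /perm12 tpermL tpermR.
by rewrite tpermD // -(inj_eq val_inj) /= !inordK.
Qed.

(** * The partition of X^3 *)

Lemma two_graph_relations_partition : Defs.indexed_partition R.
Proof.
split.
- move=> i j ij; apply/pred0P => t /=; rewrite !mem_two_graph_relations.
  by apply/negP => /andP[/eqP -> /eqP /val_inj E]; rewrite E eqxx in ij.
- apply/setP => t; rewrite in_setT; apply/bigcupP.
  exists (inord (index_of t)) => //; rewrite mem_two_graph_relations -/(index_of t).
  by rewrite inordK // triple_index_lt6.
move=> /card_gt2P[x [y [z [_ [xy yz zx]]]]].
suff wit : forall i : 'I_6, exists a b c, tau a b c = i.
  move=> i; have [a [b [c abc]]] := wit i; apply/set0Pn.
  by exists [tuple a; b; c]; rewrite mem3_two_graph_relations abc.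
case=> -[|[|[|[|[|[|//]]]]]] i6 /=.
- by exists x, x, x; rewrite /tau !eqxx.
- by exists x, y, y; rewrite /tau (negPf xy) !eqxx.
- by exists x, y, x; rewrite /tau (eq_sym y) (negPf xy) !eqxx.
- by exists x, x, y; rewrite /tau (negPf xy) !eqxx.
all: rewrite eq_sym in zx; have tauE : tau x y z = if cycle3 x y z \in nabla then 4 else 5;
  first by rewrite /tau (negPf xy) (negPf yz) (negPf zx).
(* By skewness (x, y, z) and (x, z, y) have indices 4 and 5 in some order, so both cells are
   inhabited. *)
all: have := triple_index_swap23 x y z; rewrite tauE; case: ifP tauE => _ E E'.
all: by [exists x, y, z | exists x, z, y].
Qed.

(** * Indices of degenerate and of distinct triples *)

Lemma triple_index_xyy x y : tau x y y = if y == x then 0 else 1.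
Proof. by rewrite /tau eqxx eq_sym. Qed.

Lemma triple_index_xyx x y : tau x y x = if y == x then 0 else 2.
Proof. by rewrite /tau eqxx (eq_sym x); case: eqP. Qed.

Lemma triple_index_xxy x y : tau x x y = if y == x then 0 else 3.
Proof. by rewrite /tau eqxx (eq_sym x); case: eqP. Qed.

Lemma triple_index_gt3 x y z : (3 < tau x y z) = uniq [:: x; y; z].
Proof.
rewrite /tau /= !inE negb_or andbT.
have [_|_] := eqVneq y z; first by rewrite andbF; case: ifP.
have [_|_] := eqVneq x z; first by rewrite andbF.
by do 2?[case: ifP => //].
Qed.

Lemma triple_index_uniq x y z : uniq [:: x; y; z] ->
  tau x y z = if cycle3 x y z \in nabla then 4 else 5.
Proof.
rewrite /tau /= !inE negb_or andbT => /andP[/andP[xy xz] yz].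
by rewrite (negPf xy) (negPf xz) (negPf yz).
Qed.

(** Recovers the shape of a triple for the trivial cases of (IV). The last branch stands for 4 and
    5, as indices stay below 6. *)
Lemma triple_indexP x y z :
  match tau x y z with
  | 0 => x = y /\ y = z
  | 1 => x != y /\ y = z
  | 2 => x != y /\ x = z
  | 3 => x = y /\ x != z
  | _ => uniq [:: x; y; z]
  end.
Proof.
have := triple_index_gt3 x y z; rewrite /tau.
have [<-|yz] := eqVneq y z; first by case: eqVneq.
have [->|xz] := eqVneq x z; first by rewrite eq_sym.
by case: eqVneq => // _; case: ifP.
Qed.

Lemma triple_index_parity x y z w : uniq [:: x; y; z; w] ->
  (tau w y z == 4) (+) (tau x w z == 4) (+) (tau x y w == 4) = (tau x y z != 4).
Proof.
move=> U; have := cycle3_parity U.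
move: U; rewrite /= !inE !negb_or !andbT => /and3P[/and3P[xy xz xw] /andP[yz yw] zw].
rewrite !triple_index_uniq; first by do 4!case: (_ \in _).
all: by rewrite /= !inE !negb_or 1?(eq_sym w) ?(eq_sym w) ?xy ?xz ?xw ?yz ?yw ?zw.
Qed.

Lemma sum_eq1 (x : X) n : \sum_(w : X) (w == x) * n = n.
Proof.
by rewrite (bigD1 x) //= eqxx mul1n big1 ?addn0 // => w /negPf ->.
Qed.

Lemma card_sum (P : pred X) : #|[set w | P w]| = \sum_w P w.
Proof. by rewrite -sum1dep_card big_mkcond. Qed.

(** * Valencies from regularity *)

Variable k : nat.
Hypothesis reg : forall x y, x != y ->
  #|[set z | uniq [:: x; y; z] && (cycle3 x y z \in nabla)]| = k.

(** For distinct x, y the triple (x, y, w) has index 1 only at w = y, index 2 only at w = x, and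
    never index 0 or 3. *)
Definition valency (c : nat) : nat :=
  match c with 1 | 2 => 1 | 4 | 5 => k | _ => 0 end.

Lemma card_third x y c : x != y -> #|[set w | tau x y w == c]| = valency c.
Proof.
move=> xy.
have tau4 a b : a != b -> #|[set w | tau a b w == 4]| = k.
  move=> ab; rewrite -(reg ab); apply: eq_card => w; rewrite !inE.
  have [U|U] := boolP (uniq [:: a; b; w]).
    by rewrite triple_index_uniq //; case: ifP.
  by apply/eqP => E; move: U; rewrite -triple_index_gt3 E.
have tauE w : tau x y w = if w == y then 1 else if w == x then 2
    else if cycle3 x y w \in nabla then 4 else 5.
  by rewrite /tau (negPf xy) (eq_sym y) (eq_sym x w).
case: c => [|[|[|[|[|[|c]]]]]] /=.
- by apply: eq_card0 => w; rewrite inE tauE; do 3?[case: ifP => //].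
- rewrite -[RHS](cards1 y); apply: eq_card => w; rewrite !inE tauE.
  by do 3?[case: ifP => //].
- rewrite -[RHS](cards1 x); apply: eq_card => w; rewrite !inE tauE.
  by case: (eqVneq w y) => [->|_]; [rewrite (eq_sym y) (negPf xy) | do 2?[case: ifP => //]].
- by apply: eq_card0 => w; rewrite inE tauE; do 3?[case: ifP => //].
- exact: tau4.
(* Exchanging x and y turns index 5 into 4, so regularity at (y, x) gives the same k. *)
- rewrite -(tau4 y x) 1?eq_sym //; apply: eq_card => w; rewrite !inE.
  by rewrite triple_index_swap12 (inv_eq swap12K).
by apply: eq_card0 => w; rewrite inE tauE; do 3?[case: ifP => //].
Qed.

Lemma card_second x z c :
  x != z -> #|[set w | tau x w z == c]| = valency (swap23 c).
Proof.
move=> xz; rewrite -(card_third _ xz); apply: eq_card => w; rewrite !inE.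
by rewrite triple_index_swap23 (inv_eq swap23K).
Qed.

Lemma card_first y z c :
  y != z -> #|[set w | tau w y z == c]| = valency (swap23 (swap12 c)).
Proof.
move=> yz; rewrite -(card_second _ yz); apply: eq_card => w; rewrite !inE.
by rewrite triple_index_swap12 (inv_eq swap12K).
Qed.

(** * The sets counted in (IV), over trivial triples *)

Definition fiber i j m x y z : {set X} :=
  [set w | [&& tau w y z == i, tau x w z == j & tau x y w == m]].

(** The point w = x has type (0, 0, 0), every other w has type (1, 2, 3). *)
Lemma fiber_trivial0 i j m x : #|fiber i j m x x x| =
  [&& i == 0, j == 0 & m == 0] + #|X|.-1 * [&& i == 1, j == 2 & m == 3].
Proof.
rewrite card_sum (bigD1 x) //= triple_index_xyy eqxx; congr addn.
  by rewrite !(eq_sym 0).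
rewrite (eq_bigr (fun=> [&& i == 1, j == 2 & m == 3] : nat)) => [|w wx].
  by rewrite sum_nat_const cardC1.
rewrite triple_index_xyy triple_index_xyx triple_index_xxy (eq_sym x).
by rewrite !(negPf wx) !(eq_sym _ i, eq_sym _ j, eq_sym _ m).
Qed.

(** The third coordinate of the type determines the others: the middle one by [swap23], and the
    first is 0 exactly when w = y, that is when the third is 1. The Boolean [m != 1] is read as 0 or
    1. *)
Lemma fiber_trivial1 i j m x y : x != y -> #|fiber i j m x y y| =
  [&& i == (m != 1) & j == swap23 m] * valency m.
Proof.
move=> xy; rewrite -(card_third _ xy) !card_sum big_distrr /=.
apply: eq_bigr => w _; rewrite mulnb (triple_index_swap23 x y w).
have -> : tau w y y = (tau x y w != 1).
  rewrite /tau eqxx (negPf xy) (eq_sym y w); case: eqP => //.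
  by do 2?[case: ifP => //].
by have [<-|_] := eqVneq _ m; rewrite ?andbF // !andbT !(eq_sym _ i) (eq_sym _ j).
Qed.

(** The third coordinate again decides: the first comes from reversing (x, y, w), and the middle one
    is 0 at w = x, where the third is 2, and 2 elsewhere. *)
Lemma fiber_trivial2 i j m x y : x != y -> #|fiber i j m x y x| =
  [&& i == swap12 (swap23 (swap12 m)) & j == 2 * (m != 2)] * valency m.
Proof.
move=> xy; rewrite -(card_third _ xy) !card_sum big_distrr /=.
apply: eq_bigr => w _; rewrite mulnb.
rewrite triple_index_swap12 triple_index_swap23 (triple_index_swap12 x y w).
have -> : tau x w x = 2 * (tau x y w != 2).
  rewrite triple_index_xyx /tau (negPf xy) (eq_sym y w) (eq_sym x w).
  case: (eqVneq w y) => [->|_]; first by rewrite (eq_sym y) (negPf xy).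
  by do 2?[case: ifP => //].
by have [<-|_] := eqVneq _ m; rewrite ?andbF // !andbT !(eq_sym _ i) (eq_sym _ j).
Qed.

(** Now the first coordinate decides: the third is 0 at w = x, where the first is 3, and 3
    elsewhere. *)
Lemma fiber_trivial3 i j m x z : x != z -> #|fiber i j m x x z| =
  [&& j == swap12 i & m == 3 * (i != 3)] * valency (swap23 (swap12 i)).
Proof.
move=> xz; rewrite -(card_first _ xz) !card_sum big_distrr /=.
apply: eq_bigr => w _; rewrite mulnb (triple_index_swap12 w x z).
have -> : tau x x w = 3 * (tau w x z != 3).
  rewrite triple_index_xxy /tau (negPf xz); case: (eqVneq w x) => [->|_].
    by rewrite (negPf xz).
  by do 2?[case: ifP => //].
by have [<-|_] := eqVneq _ i; rewrite ?andbF //= !andbT (eq_sym _ j) (eq_sym _ m).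
Qed.

(** * The sets counted in (IV), over triples of distinct points *)

Lemma fiberP x y z w : 3 < tau x y z ->
  [\/ w = x, w = y, w = z
    | [/\ [&& w != x, w != y & w != z], uniq [:: x; y; z; w], 3 < tau w y z,
          3 < tau x w z & 3 < tau x y w]].
Proof.
rewrite !triple_index_gt3 /= !inE !negb_or !andbT => /andP[/andP[xy xz] yz].
have [|wx] := eqVneq w x; first by constructor.
have [|wy] := eqVneq w y; first by constructor.
have [|wz] := eqVneq w z; first by constructor.
by constructor; rewrite ?(eq_sym _ w) ?wx ?wy ?wz ?xy ?xz ?yz.
Qed.

Lemma neq_of_triple_index x y z : 3 < tau x y z ->
  [/\ (x == y) = false, (x == z) = false & (y == z) = false].
Proof.
rewrite triple_index_gt3 /= !inE negb_or andbT => /andP[/andP[]].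
by split; apply/negbTE.
Qed.

(** A type with a trivial coordinate forces w into {x, y, z}; the three summands are the types of w
    = x, w = y and w = z. *)
Lemma fiber_mixed i j m x y z :
    3 < tau x y z -> ~~ [&& 3 < i, 3 < j & 3 < m] ->
  #|fiber i j m x y z| =
    [&& i == tau x y z, j == 3 & m == 2] + [&& i == 3, j == tau x y z & m == 1]
    + [&& i == 2, j == 1 & m == tau x y z].
Proof.
move=> l3 triv; have [xy xz yz] := neq_of_triple_index l3.
have yx : (y == x) = false by rewrite eq_sym.
have zx : (z == x) = false by rewrite eq_sym.
have zy : (z == y) = false by rewrite eq_sym.
pose T a b c : nat := [&& i == a, j == b & m == c].
transitivity (\sum_w ((w == x) * T (tau x y z) 3 2 + (w == y) * T 3 (tau x y z) 1
    + (w == z) * T 2 1 (tau x y z))); last by rewrite !big_split /= !sum_eq1.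
rewrite card_sum; apply: eq_bigr => w _; rewrite {}/T.
have [->|->|->|[/and3P[wx wy wz] _ w1 w2 w3]] := fiberP w l3.
- rewrite eqxx xy xz mul1n !mul0n !addn0 triple_index_xxy triple_index_xyx zx yx.
  by rewrite !(eq_sym _ i, eq_sym _ j, eq_sym _ m).
- rewrite eqxx yx yz mul1n !mul0n !addn0 triple_index_xxy triple_index_xyy zy yx.
  by rewrite !(eq_sym _ i, eq_sym _ j, eq_sym _ m).
- rewrite eqxx zx zy mul1n !mul0n triple_index_xyx triple_index_xyy yz zx.
  by rewrite !(eq_sym _ i, eq_sym _ j, eq_sym _ m).
rewrite (negPf wx) (negPf wy) (negPf wz); apply/eqP; rewrite eqb0.
by apply: contra triv => /and3P[/eqP <- /eqP <- /eqP <-]; apply/and3P.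
Qed.

(** The points x, y, z have a trivial coordinate in their type, and any other w would violate the
    parity law. *)
Lemma fiber_odd i j m x y z :
    3 < tau x y z -> 3 < i -> 3 < j -> 3 < m ->
    (i == 4) (+) (j == 4) (+) (m == 4) = (tau x y z == 4) ->
  #|fiber i j m x y z| = 0.
Proof.
move=> l3 i3 j3 m3 odd; apply: eq_card0 => w; rewrite inE; apply/and3P.
move=> [/eqP E1 /eqP E2 /eqP E3]; have [ew|ew|ew|[_ U _ _ _]] := fiberP w l3.
- by move: j3; rewrite -E2 ew triple_index_xxy; case: ifP.
- by move: i3; rewrite -E1 ew triple_index_xxy; case: ifP.
- by move: j3; rewrite -E2 ew triple_index_xyy; case: ifP.
by have := triple_index_parity U; rewrite E1 E2 E3 odd; case: (_ == _).
Qed.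

(* If w is none of x, y, z, then an even number of the three coordinates of its
   type differ from (i, j, m), so that twice the indicator of the fiber plus 1
   is the number of coordinates that agree. Summing over w leaves only
   valencies. *)
Lemma fiber_even i j m x y z :
    3 < tau x y z -> 3 < i < 6 -> 3 < j < 6 -> 3 < m < 6 ->
    (i == 4) (+) (j == 4) (+) (m == 4) = (tau x y z != 4) ->
  2 * #|fiber i j m x y z| + #|X|
    + ((tau x y z == i) + (tau x y z == j) + (tau x y z == m)) = 3 * k + 3.
Proof.
move=> l3 i46 j46 m46 even; have [xy xz yz] := neq_of_triple_index l3.
have yx : (y == x) = false by rewrite eq_sym.
have zx : (z == x) = false by rewrite eq_sym.
have zy : (z == y) = false by rewrite eq_sym.
have val1 : \sum_w (tau w y z == i) = k.
  rewrite -card_sum card_first ?yz //.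
  by case: i i46 {even} => [|[|[|[|[|[|i]]]]]].
have val2 : \sum_w (tau x w z == j) = k.
  rewrite -card_sum card_second ?xz //.
  by case: j j46 {even} => [|[|[|[|[|[|j]]]]]].
have val3 : \sum_w (tau x y w == m) = k.
  rewrite -card_sum card_third ?xy //.
  by case: m m46 {even} => [|[|[|[|[|[|m]]]]]].
have sum1 (u : X) : \sum_w (w == u) = 1.
  by rewrite -[RHS](sum_eq1 u); apply: eq_bigr => w _; rewrite muln1.
(* The summand 3 counts x, y, z once each, so that the identity can be checked pointwise in w. *)
have -> : 3 * k + 3 = \sum_w ((tau w y z == i) + (tau x w z == j)
    + (tau x y w == m) + (w == x) + (w == y) + (w == z)).
  by rewrite !big_split /= val1 val2 val3 !sum1; lia.
transitivity (\sum_w (2 * [&& tau w y z == i, tau x w z == j & tau x y w == m] + 1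
    + ((w == x) * (tau x y z == i) + (w == y) * (tau x y z == j)
       + (w == z) * (tau x y z == m)))).
  by rewrite card_sum big_distrr !big_split /= !sum_eq1 sum1_card.
apply: eq_bigr => w _.
(* At w in {x, y, z} two coordinates are trivial and cannot match, so both sides are 1 plus the
   indicator of the remaining match. *)
have [->|->|->|[/and3P[wx wy wz] U w1 w2 w3]] := fiberP w l3.
- rewrite eqxx xy xz triple_index_xxy triple_index_xyx zx yx.
  by case: j j46 {even val2} => [|[|[|[|j]]]] //= _; rewrite andbF; lia.
- rewrite eqxx yx yz triple_index_xxy triple_index_xyy zy yx.
  by case: i i46 {even val1} => [|[|[|[|i]]]] //= _; lia.
- rewrite eqxx zx zy triple_index_xyx triple_index_xyy yz zx.
  by case: i i46 {even val1} => [|[|[|[|i]]]] //= _; lia.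
(* Only 4 and 5 remain, so agreement of indices becomes a Boolean identity governed by parity. *)
have eq46 a b : 3 < a < 6 -> 3 < b -> b < 6 -> (b == a) = ((a == 4) == (b == 4)).
  by case: a => [|[|[|[|[|[|a]]]]]] //; case: b => [|[|[|[|[|[|b]]]]]].
rewrite (negPf wx) (negPf wy) (negPf wz) !(eq46 i) ?(eq46 j) ?(eq46 m) ?triple_index_lt6 //.
have := triple_index_parity U; rewrite -even.
by do 6!case: (_ == 4).
Qed.

(** * Conditions (III) and (IV), skew symmetry and the vanishing numbers *)

Lemma two_graph_intersection_number i j m l :
  exists p, intersection_number R i j m l p.
Proof.
suff [p pE] : exists p, forall x y z, tau x y z = l -> #|fiber i j m x y z| = p.
  exists p => x y z; rewrite mem3_two_graph_relations => /eqP /pE <-.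
  by apply: eq_card => w; rewrite !inE !mem3_two_graph_relations.
have [l3|l3] := ltnP 3 l; last first.
  suff /(_ l3) : l <= 3 -> exists p, forall x y z,
    tau x y z = l -> #|fiber i j m x y z| = p by [].
  case: l {l3} => -[|[|[|[|//]]]] l6 _ /=.
  (* The closed formulas over trivial triples do not mention the points, so each serves as the
     witness. *)
  - eexists => x y z E; have := triple_indexP x y z.
    by rewrite E => -[-> ->]; apply: fiber_trivial0.
  - eexists => x y z E; have := triple_indexP x y z.
    by rewrite E => -[xy <-]; apply: fiber_trivial1.
  - eexists => x y z E; have := triple_indexP x y z.
    by rewrite E => -[xy <-]; apply: fiber_trivial2.
  eexists => x y z E; have := triple_indexP x y z.
  by rewrite E => -[<- xz]; apply: fiber_trivial3.
have [/and3P[i3 j3 m3]|triv] := boolP [&& 3 < i, 3 < j & 3 < m]; last first.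
  by eexists => x y z E; rewrite fiber_mixed ?E.
have [even|odd] := eqVneq ((i == 4 :> nat) (+) (j == 4 :> nat) (+) (m == 4 :> nat))
  (l != 4 :> nat).
  (* This solves [fiber_even] for the cardinality; that equation makes the truncated subtraction and
     the halving exact whenever a triple of index [l] exists. *)
  exists ((3 * k + 3 - #|X| - ((l == i) + (l == j) + (l == m)))./2) => x y z E.
  have := @fiber_even i j m x y z; rewrite E !ltn_ord !andbT.
  by move=> /(_ l3 i3 j3 m3 even) <-; rewrite -!val_eqE /=; lia.
exists 0 => x y z E; apply: fiber_odd; rewrite ?E //.
by move: odd; do 4!case: (_ == _ :> nat).
Qed.

Lemma two_graph_valency i : exists n : nat, forall y z : X, y != z ->
  #|[set x : X | [tuple x; y; z] \in R i]| = n.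
Proof.
eexists => y z yz; apply: etrans (card_first i yz).
by apply: eq_card => x; rewrite !inE mem3_two_graph_relations.
Qed.

Lemma two_graph_relations_AST : association_scheme_on_triples R.
Proof.
split.
- exact: two_graph_relations_partition.
- by split; rewrite // /two_graph_relations (tnth_nth (trivial0 X)) inordK.
- exact: permute_two_graph_relations.
- exact: two_graph_valency.
exact: two_graph_intersection_number.
Qed.

Lemma two_graph_relations_skew_symmetric : skew_symmetric_AST R.
Proof.
(* A rotation is two swaps, each exchanging 4 and 5, hence it fixes both. *)
have perm123R i j : swap23 (swap12 i) = j -> i < 6 -> j < 6 ->
    permute_rel perm123 (R (inord i)) = R (inord j).
  move=> ij i6 j6; apply: permute_two_graph_relation index_of_perm123.
    by apply: inj_comp; apply: inv_inj; [apply: swap23K | apply: swap12K].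
  by rewrite !inordK.
have perm12R i j : swap12 i = j -> i < 6 -> j < 6 ->
    permute_rel perm12 (R (inord i)) = R (inord j).
  move=> ij i6 j6; apply: permute_two_graph_relation index_of_perm12.
    exact: inv_inj swap12K.
  by rewrite !inordK.
have [disj _ _] := two_graph_relations_partition.
split; first exact: two_graph_relations_AST.
- exact: perm123R.
- exact: perm123R.
- rewrite (perm12R 4 5) //; apply/eqP; rewrite setI_eq0; apply: disj.
  by rewrite -val_eqE /= !inordK.
rewrite (perm12R 5 4) //; apply/eqP; rewrite setI_eq0; apply: disj.
by rewrite -val_eqE /= !inordK.
Qed.

Lemma two_graph_intersection_number0 i j m l :
    3 < l < 6 -> 3 < i < 6 -> 3 < j < 6 -> 3 < m < 6 ->
    (i == 4) (+) (j == 4) (+) (m == 4) = (l == 4) ->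
  intersection_number R (inord i) (inord j) (inord m) (inord l) 0.
Proof.
move=> /andP[l3 l6] /andP[i3 i6] /andP[j3 j6] /andP[m3 m6] odd x y z.
rewrite mem3_two_graph_relations inordK // => /eqP lE.
rewrite -[RHS](@fiber_odd i j m x y z) ?lE //.
by apply: eq_card => w; rewrite !inE !mem3_two_graph_relations !inordK.
Qed.

End RelationIndex.

Theorem theorem3p2 (X : finType) (nabla : {set {perm X}})
    (Hnabla : regular_skew_two_graph nabla) :
  let R := two_graph_relations nabla in
  [/\ skew_symmetric_AST R,
      intersection_number R (inord 4) (inord 4) (inord 4) (inord 4) 0,
      intersection_number R (inord 4) (inord 4) (inord 5) (inord 5) 0,
      intersection_number R (inord 4) (inord 5) (inord 5) (inord 4) 0
    & intersection_number R (inord 5) (inord 5) (inord 5) (inord 5) 0].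
Proof.
have [stg [k reg]] := Hnabla.
(* The lower indices contain three, two, one and no 4's, against upper index 4, 5, 4, 5: each time
   the parity excluded by (S2). *)
by split; [exact: (two_graph_relations_skew_symmetric stg reg) | ..];
  apply: two_graph_intersection_number0.
Qed.
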